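(* If $F$ is a 3-resonant fullerene graph, then $|V(F)|\le 60$.
   Context: A fullerene graph is a 3-connected plane cubic graph with exactly 12 pentagonal faces and all other faces hexagonal. A set $\mathcal H$ of pairwise vertex-disjoint hexagonal faces is a resonant pattern if the graph has a perfect matching $M$ such that every hexagon in $\mathcal H$ is $M$-alternating (edges alternately in and off $M$), equivalently the graph minus all vertices of the hexagons in $\mathcal H$ has a perfect matching. A fullerene graph is $k$-resonant if every set of $i$ pairwise disjoint hexagons, for each $0\le i\le k$, is a resonant pattern. *)

(* Defs.v *)
From mathcomp Require Import all_boot all_fingroup.

Set Implicit Arguments.
Unset Strict Implicit.
Unset Printing Implicit Defensive.

(* Plane graphs are represented combinatorially: a finite simple graph together
   with a rotation system, i.e. a cyclic order of the darts (oriented edges)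
   leaving each vertex.  By the Heffter-Edmonds correspondence, the rotation
   systems of a connected graph (with at least one edge) are its cellular
   embeddings in oriented closed surfaces, up to orientation-preserving
   homeomorphism; those of genus 0 are the embeddings in the sphere.  The face
   of a plane graph that is unbounded is a face like any other here. *)

Record simple_graph := SimpleGraph {
  vertex : finType;
  adj : rel vertex;
  adj_sym : symmetric adj;
  adj_irr : irreflexive adj
}.

Section Graph.
Variable G : simple_graph.
Implicit Types (v : vertex G) (A S : {set vertex G}) (M : {set {set vertex G}}).

Definition edges : {set {set vertex G}} :=
  [set [set p.1; p.2] | p : vertex G * vertex G & adj p.1 p.2].

Definition neighbours v : {set vertex G} := [set w | adj v w].

Definition cubic : Prop := forall v, #|neighbours v| = 3.

Definition induced_connected A : Prop :=
  {in A &, forall x y,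
    connect [rel u w | [&& u \in A, w \in A & adj u w]] x y}.

Definition k_connected (k : nat) : Prop :=
  k < #|vertex G| /\ forall S, #|S| < k -> induced_connected (~: S).

Definition perfect_matching M : Prop :=
  M \subset edges /\ forall v, #|[set E in M | v \in E]| = 1.

Definition dart : finType := {p : vertex G * vertex G | adj p.1 p.2}.

Definition tail (d : dart) : vertex G := (val d).1.
Definition head (d : dart) : vertex G := (val d).2.
Definition dart_edge (d : dart) : {set vertex G} := [set tail d; head d].

Lemma reverse_proof (d : dart) : adj (head d) (tail d).
Proof. by rewrite adj_sym; apply: (valP d). Qed.

Definition reverse_dart (d : dart) : dart :=
  exist (fun p : vertex G * vertex G => adj p.1 p.2)
        (head d, tail d) (reverse_proof d).

Lemma reverse_dartK : involutive reverse_dart.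
Proof. by move=> d; apply: val_inj; rewrite [RHS]surjective_pairing. Qed.

Definition reverse : {perm dart} := perm (inv_inj reverse_dartK).

End Graph.

Record map_graph := MapGraph {
  graph :> simple_graph;
  rotation : {perm dart graph};
  rotationP : forall d : dart graph,
    porbit rotation d = [set d' | tail d' == tail d]
}.

Section MapGraph.
Variable G : map_graph.
Implicit Types (f : {set dart G}) (H : {set {set dart G}}).
Implicit Types (M : {set {set vertex G}}).

(* Products of permutations compose from left to right: (u, v) is sent to the
   dart that follows (v, u) in the rotation at v. *)
Definition face_next : {perm dart G} := (reverse G * rotation G)%g.

(* A face is given by the set of darts of its boundary walk.  The number of
   these darts is the length of the face; when G is 3-connected of genus 0,
   every boundary walk is a cycle of G. *)
Definition faces : {set {set dart G}} := porbits face_next.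

Definition face_vertices f : {set vertex G} := [set tail d | d in f].

(* Euler's formula for genus 0; meant for connected graphs with an edge. *)
Definition genus0 : Prop := #|vertex G| + #|faces| = #|edges G| + 2.

Definition pentagons : {set {set dart G}} := [set f in faces | #|f| == 5].
Definition hexagons : {set {set dart G}} := [set f in faces | #|f| == 6].

Definition fullerene : Prop :=
  [/\ k_connected G 3, genus0, cubic G,
      #|pentagons| = 12 & faces = pentagons :|: hexagons].

Definition vertex_disjoint H : Prop :=
  {in H &, forall f1 f2,
    f1 != f2 -> [disjoint face_vertices f1 & face_vertices f2]}.

Definition alternating M f : Prop :=
  {in f, forall d,
    (dart_edge (face_next d) \in M) = (dart_edge d \notin M)}.

Definition resonant_pattern H : Prop :=
  [/\ H \subset hexagons, vertex_disjoint H
    & exists2 M, perfect_matching M & {in H, forall f, alternating M f}].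

Definition k_resonant (k : nat) : Prop :=
  forall i, i <= k -> forall H,
    H \subset hexagons -> vertex_disjoint H -> #|H| = i -> resonant_pattern H.

End MapGraph.

(* Main.v *)
Require Import Defs.
From mathcomp Require Import all_boot all_fingroup all_algebra.
From mathcomp Require Import zify.
(* [head] and [tail] denote the ends of a dart again, not functions on lists. *)
Import Defs.

(* Let v be a vertex, and call outer faces of v the faces that contain a
   neighbour w of v but not the edge vw.  If the three outer faces of v were all
   hexagons, they would form a resonant pattern, because they are pairwise
   disjoint; but each neighbour of v is matched along its hexagon, so v would be
   left unmatched.  Hence every vertex has an outer pentagon, and as each of the
   12 pentagons is an outer face of 5 vertices, there are at most 60 vertices.

   If two outer faces of v met, they would form, with the face at v between
   them, a cycle of length at most 3 in the dual graph.  In genus 0 the edges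
   crossed by such a cycle are a cut (comparing ranks over F_2 with Euler's
   formula), and cuts of size at most 2 are excluded by 3-connectivity.  For a
   cut of size 3 the three faces crossing it have at most 18 darts, hence one
   side has a boundary of at most 6 darts; peeling off the boundary vertices of
   that side gives a smaller 3-cut of the same kind, until one ends up with a
   side too small to be tiled by faces of length 5 and 6. *)

Set Implicit Arguments.
Unset Strict Implicit.
Unset Printing Implicit Defensive.

(** * Darts and faces *)

Section Darts.
Variable G : map_graph.
Implicit Types (d o : dart G) (S : {set vertex G}) (X f : {set dart G}).

Local Notation rev := (@reverse_dart G).
Local Notation rot := (rotation G).
Local Notation next := (face_next G).

Definition face_of d : {set dart G} := porbit next d.

Definition leaving S : {set dart G} :=
  [set d | (tail d \in S) && (head d \notin S)].
Definition inner S : {set dart G} :=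
  [set d | (tail d \in S) && (head d \in S)].

Lemma leavingE S d : (d \in leaving S) = (tail d \in S) && (head d \notin S).
Proof. by rewrite inE. Qed.

Lemma innerE S d : (d \in inner S) = (tail d \in S) && (head d \in S).
Proof. by rewrite inE. Qed.

Lemma revK : involutive rev. Proof. exact: reverse_dartK. Qed.

Lemma rev_inj : injective rev. Proof. exact: inv_inj revK. Qed.

Lemma dart_ext d d' : tail d = tail d' -> head d = head d' -> d = d'.
Proof.
move=> eqt eqh; apply: val_inj.
by rewrite [LHS]surjective_pairing [RHS]surjective_pairing; congr pair.
Qed.

Lemma tail_neq_head d : tail d != head d.
Proof.
by apply/eqP => eqd; have:= valP d; rewrite -/(tail d) -/(head d) eqd adj_irr.
Qed.

Lemma nextE d : next d = rot (rev d).
Proof. by rewrite permM permE. Qed.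

Lemma tail_rot d : tail (rot d) = tail d.
Proof.
by have := mem_porbit rot 1 d; rewrite rotationP inE expg1 => /eqP.
Qed.

Lemma tail_next d : tail (next d) = head d.
Proof. by rewrite nextE tail_rot. Qed.

Lemma face_of_id d : d \in face_of d.
Proof. exact: porbit_id. Qed.

Lemma face_of_eq d d' : (face_of d == face_of d') = (d \in face_of d').
Proof. exact: eq_porbit_mem. Qed.

Lemma face_ofP d d' : reflect (face_of d = face_of d') (d \in face_of d').
Proof. by rewrite -face_of_eq; apply: eqP. Qed.

Lemma face_of_next d : face_of (next d) = face_of d.
Proof. by have := porbit_perm next 1 d; rewrite expg1. Qed.

Lemma next_rev d : next (rev d) = rot d.
Proof. by rewrite nextE revK. Qed.

Lemma face_of_rot d : face_of (rot d) = face_of (rev d).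
Proof. by rewrite -next_rev face_of_next. Qed.

Lemma face_of_in_faces d : face_of d \in faces G.
Proof. exact: imset_f. Qed.

Lemma facesP f : reflect (exists d, f = face_of d) (f \in faces G).
Proof.
by apply: (iffP imsetP) => [[d _ ->]|[d ->]]; exists d.
Qed.

Lemma face_of_sub X d :
  {in X, forall d', next d' \in X} -> d \in X -> face_of d \subset X.
Proof.
move=> stX Xd; apply/subsetP => d' /porbitP[i ->].
elim: i => [|i IHi]; first by rewrite expg0 perm1.
by rewrite expgSr permM; apply: stX.
Qed.

Lemma leavingC S : leaving (~: S) = rev @: leaving S.
Proof.
apply/setP => d; rewrite -[d in RHS]revK (mem_imset _ _ rev_inj) !inE negbK.
by rewrite andbC.
Qed.

Lemma card_leavingC S : #|leaving (~: S)| = #|leaving S|.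
Proof. by rewrite leavingC card_imset //; exact: rev_inj. Qed.

Lemma face_count S f : f \in faces G ->
  #|f :&: leaving S| = #|f :&: (rev @: leaving S)|.
Proof.
case/facesP=> d0 ->{f}; set f := face_of d0.
have nextf d : (next d \in f) = (d \in f).
  by rewrite -!face_of_eq face_of_next.
pose A := [set d in f | tail d \in S]; pose B := [set d in f | head d \in S].
have cAB : #|A| = #|B|.
  rewrite -(card_preimset A (@perm_inj _ next)).
  by apply: eq_card => d; rewrite !inE nextf tail_next.
have cA : #|A| = #|f :&: inner S| + #|f :&: leaving S|.
  rewrite -(cardsID [set d | head d \in S] A).
  by congr (_ + _); apply: eq_card => d; rewrite !inE; case: (d \in f);
     case: (tail d \in S); case: (head d \in S).
have cB : #|B| = #|f :&: inner S| + #|f :&: (rev @: leaving S)|.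
  rewrite -(cardsID [set d | tail d \in S] B) -leavingC.
  by congr (_ + _); apply: eq_card => d; rewrite !inE ?negbK; case: (d \in f);
     case: (tail d \in S); case: (head d \in S).
by move: cAB; rewrite cA cB; lia.
Qed.

Section Cubic.
Hypothesis cubicG : cubic G.

Lemma card_darts_at v : #|[set d : dart G | tail d == v]| = 3.
Proof.
rewrite -(cubicG v) -(card_in_imset (f := @head G)); last first.
  move=> d d'; rewrite !inE => /eqP td /eqP td' eqh.
  by apply: dart_ext; rewrite // td td'.
apply: eq_card => w; apply/imsetP/idP => [[d]|].
  by rewrite !inE => /eqP<- ->; exact: (valP d).
rewrite inE => avw.
by exists (exist (fun p : vertex G * vertex G => adj p.1 p.2) (v, w) avw);
  rewrite ?inE.
Qed.

Lemma card_porbit_rot d : #|porbit rot d| = 3.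
Proof. by rewrite rotationP card_darts_at. Qed.

Lemma rot3 d : rot (rot (rot d)) = d.
Proof. by have := iter_porbit rot d; rewrite card_porbit_rot. Qed.

Lemma rot_uniq d : uniq [:: d; rot d; rot (rot d)].
Proof. by have := uniq_traject_porbit rot d; rewrite card_porbit_rot. Qed.

Lemma rot_neq d : rot d != d.
Proof. by have /and3P[] := rot_uniq d; rewrite !inE eq_sym => /norP[]. Qed.

Lemma rot2_neq d : rot (rot d) != d.
Proof. by have /and3P[] := rot_uniq d; rewrite !inE orbC eq_sym => /norP[]. Qed.

Lemma same_tail d d' :
  tail d' = tail d -> [\/ d' = d, d' = rot d | d' = rot (rot d)].
Proof.
move=> eqt.
have : d' \in porbit rot d by rewrite rotationP inE eqt.
rewrite porbit_traject card_porbit_rot !inE.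
by case/or3P => /eqP; [constructor 1 | constructor 2 | constructor 3].
Qed.

Lemma exists_dart v : exists d : dart G, tail d = v.
Proof.
have : 0 < #|[set d : dart G | tail d == v]| by rewrite card_darts_at.
by rewrite card_gt0 => /set0Pn[d]; rewrite inE => /eqP; exists d.
Qed.

Lemma next_prev d : next (rev (rot (rot d))) = d.
Proof. by rewrite next_rev rot3. Qed.

Lemma face_of_prev d : face_of (rev (rot (rot d))) = face_of d.
Proof. by rewrite -face_of_next next_prev. Qed.

Lemma card_inner S : #|inner S| + #|leaving S| = 3 * #|S|.
Proof.
have -> : #|inner S| + #|leaving S| = #|[set d : dart G | tail d \in S]|.
  rewrite -(cardsID [set d | head d \in S] [set d : dart G | tail d \in S]).
  by congr (_ + _); apply: eq_card => d; rewrite !inE // andbC.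
rewrite -sum1_card (partition_big (@tail G) (mem S)) => [|d];
  last by rewrite inE.
rewrite mulnC -sum_nat_const; apply: eq_bigr => v Sv.
rewrite -(card_darts_at v) -sum1_card; apply: eq_bigl => d.
by rewrite !inE; case: eqP => [->|_]; rewrite ?andbF ?andbT.
Qed.

End Cubic.
End Darts.

(** * Dual cycles are cuts *)

Section Rank.
Import GRing.Theory.
Local Open Scope ring_scope.

Lemma rank_kernel_const (K : fieldType) (m n : nat) (A : 'M[K]_(m, n)) :
  (forall u : 'rV_m, u *m A = 0 -> forall i j, u 0 i = u 0 j) ->
  (m.-1 <= \rank A)%N.
Proof.
case: m A => [|m] A kerA //=.
have subk : (kermx A <= (const_mx 1 : 'rV[K]_m.+1))%MS.
  apply/row_subP => i; have : row i (kermx A) *m A = 0.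
    by rewrite -row_mul mulmx_ker row0.
  move: (row i _) => u uA.
  suff -> : u = u 0 0 *: const_mx 1 by rewrite scalemx_sub.
  by apply/rowP => j; rewrite !mxE mulr1; exact: kerA.
have := leq_trans (mxrankS subk) (rank_leq_row _).
by rewrite mxrank_ker; lia.
Qed.

Lemma exact_of_rank (K : fieldType) (m n p : nat)
    (A : 'M[K]_(m, n)) (B : 'M[K]_(n, p)) :
  A *m B = 0 -> (n <= \rank A + \rank B)%N ->
  forall x : 'cV_n, A *m x = 0 -> exists y, x = B *m y.
Proof.
move=> AB0 rAB x Ax0.
have sub : (B^T <= kermx A^T)%MS.
  by apply/sub_kermxP; rewrite -trmx_mul AB0 trmx0.
have := mxrank_leqif_sup sub; rewrite mxrank_ker !mxrank_tr => -[rle].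
have -> : (\rank B == n - \rank A)%N by rewrite eqn_leq rle leq_subLR.
move/esym => kerB.
have xk : (x^T <= kermx A^T)%MS.
  by apply/sub_kermxP; rewrite -trmx_mul Ax0 trmx0.
have /submxP[y xy] := submx_trans xk kerB.
by exists y^T; apply: trmx_inj; rewrite trmx_mul trmxK.
Qed.

End Rank.

Section DualCycle.
Variable G : map_graph.
Hypotheses (conG : k_connected G 3) (genG : genus0 G) (cubicG : cubic G).
Implicit Types (d o : dart G) (S : {set vertex G}) (X f : {set dart G}).

Local Notation rev := (@reverse_dart G).
Local Notation rot := (rotation G).
Local Notation next := (face_next G).

Lemma connected_const (T : Type) (h : vertex G -> T) :
  (forall d, h (tail d) = h (head d)) -> forall v w, h v = h w.
Proof.
move=> hd v w.
case: conG => _ /(_ set0); rewrite cards0 setC0 => /(_ isT v w).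
rewrite !inE => /(_ isT isT) /connectP[p pP ->].
elim: p v pP => //= u p IHp v /andP[]; rewrite !inE /= => avu /IHp <-.
exact: (hd (exist (fun p : vertex G * vertex G => adj p.1 p.2) (v, u) avu)).
Qed.

Lemma dart_edge_rev d : dart_edge (rev d) = dart_edge d.
Proof. by rewrite /dart_edge setUC. Qed.

Lemma dart_edge_inj d d' :
  dart_edge d = dart_edge d' -> d = d' \/ d = rev d'.
Proof.
move=> eqe.
have tn := tail_neq_head d.
have : tail d \in dart_edge d' by rewrite -eqe !inE eqxx.
have : head d \in dart_edge d' by rewrite -eqe !inE eqxx orbT.
rewrite !inE => /orP[]/eqP hd /orP[]/eqP td.
- by rewrite td hd eqxx in tn.
- by right; apply: dart_ext.
- by left; apply: dart_ext.
- by rewrite td hd eqxx in tn.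
Qed.

Lemma edgesP (E : {set vertex G}) :
  reflect (exists d, E = dart_edge d) (E \in edges G).
Proof.
apply: (iffP imsetP) => [[p]|[d ->]].
  by rewrite inE => ap ->;
    exists (exist (fun p : vertex G * vertex G => adj p.1 p.2) p ap).
by exists (val d); rewrite ?inE //; exact: (valP d).
Qed.

Import GRing.Theory.
Local Open Scope ring_scope.

Let K := 'F_2.
Let nV := #|vertex G|.
Let nE := #|edges G|.
Let nF := #|faces G|.


Lemma dart_edge_in d : dart_edge d \in edges G.
Proof. by apply/edgesP; exists d. Qed.

Let fidx d : 'I_nF := enum_rank_in (face_of_in_faces d) (face_of d).
Let eidx d : 'I_nE := enum_rank_in (dart_edge_in d) (dart_edge d).

Let fidxE d : enum_val (fidx d) = face_of d.
Proof. exact: enum_rankK_in (face_of_in_faces d). Qed.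

Let eidxE d : enum_val (eidx d) = dart_edge d.
Proof. exact: enum_rankK_in (dart_edge_in d). Qed.

Let fidx_eq i d : (i == fidx d) = (d \in (enum_val i : {set dart G})).
Proof.
rewrite -(inj_eq enum_val_inj) fidxE.
by have /facesP[d' ->] := enum_valP i; rewrite eq_sym face_of_eq.
Qed.

Let fidx_surj i : exists d, i = fidx d.
Proof.
have /facesP[d eqd] := enum_valP i.
by exists d; apply/eqP; rewrite fidx_eq eqd face_of_id.
Qed.

Let eidx_rev d : eidx (rev d) = eidx d.
Proof. by apply/enum_val_inj; rewrite !eidxE dart_edge_rev. Qed.

Let eidx_eq d d' : (eidx d == eidx d') = (d' == d) || (d' == rev d).
Proof.
apply/eqP/orP => [|[]/eqP->]; rewrite ?eidx_rev //.
move/(congr1 enum_val); rewrite !eidxE => /esym /dart_edge_inj.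
by case=> ->; rewrite eqxx; [left | right].
Qed.

Let fidx_next d : fidx (next d) = fidx d.
Proof. by apply/enum_val_inj; rewrite !fidxE face_of_next. Qed.

Let boundary : 'M[K]_(nF, nE) :=
  \matrix_(i, j) \sum_(d | i == fidx d) (j == eidx d)%:R.
Let coboundary : 'M[K]_(nE, nV) :=
  \matrix_(j, k) (enum_val k \in (enum_val j : {set vertex G}))%:R.

Let F2_add (x : K) : x + x = 0.
Proof. by rewrite -mulr2n mulrn_pchar ?pchar_Fp. Qed.

Let F2_eq (x y : K) : x + y = 0 -> x = y.
Proof. by move=> xy0; apply: (addIr y); rewrite xy0 F2_add. Qed.

Let boundary_mul p (B : 'M_(nE, p)) i k :
  (boundary *m B) i k = \sum_(d | i == fidx d) B (eidx d) k.
Proof.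
rewrite mxE; under eq_bigr => j _ do rewrite mxE mulr_suml.
rewrite exchange_big; apply: eq_bigr => d _ /=.
rewrite (bigD1 (eidx d)) //= eqxx mul1r big1 ?addr0 // => j /negPf->.
by rewrite mul0r.
Qed.

Let coboundaryE d k : coboundary (eidx d) k =
  (k == enum_rank (tail d))%:R + (k == enum_rank (head d))%:R.
Proof.
rewrite mxE eidxE !inE -!(can2_eq enum_valK enum_rankK).
have := tail_neq_head d.
case: (eqVneq (enum_val k) (tail d)) => [->|_] => [/negPf->|_].
  by rewrite addr0.
by rewrite add0r.
Qed.

Let coboundary_mul p (B : 'M_(nV, p)) d k : (coboundary *m B) (eidx d) k =
  B (enum_rank (tail d)) k + B (enum_rank (head d)) k.
Proof.
rewrite mxE; under eq_bigr => j _ do rewrite coboundaryE mulrDl.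
rewrite big_split; congr (_ + _).
  rewrite (bigD1 (enum_rank (tail d))) //= eqxx mul1r big1 ?addr0 // =>
    j /negPf->.
  by rewrite mul0r.
rewrite (bigD1 (enum_rank (head d))) //= eqxx mul1r big1 ?addr0 // =>
  j /negPf->.
by rewrite mul0r.
Qed.

Let boundary_coboundary : boundary *m coboundary = 0.
Proof.
apply/matrixP => i k; rewrite boundary_mul [RHS]mxE.
under eq_bigr => d _ do rewrite coboundaryE.
rewrite big_split /= [X in X + _](reindex_inj (@perm_inj _ next)) /=.
under eq_bigl => d do rewrite fidx_next.
rewrite -big_split /=.
by rewrite big1 // => d _; rewrite tail_next F2_add.
Qed.

Let rank_boundary : (nF.-1 <= \rank boundary)%N.
Proof.
apply: rank_kernel_const => u uA0.
have urev d : u 0 (fidx d) = u 0 (fidx (rev d)).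
  have := congr1 (fun M : 'rV_nE => M 0 (eidx d)) uA0; rewrite !mxE.
  under eq_bigr => i _ do rewrite mxE mulr_sumr big_mkcond.
  rewrite exchange_big /=.
  have nrd : rev d != d.
    apply/eqP => rd; have := tail_neq_head d.
    by rewrite -[in head d]rd eqxx.
  have sumE d' : \sum_i (if i == fidx d' then u 0 i * (eidx d == eidx d')%:R
    else 0)
                 = u 0 (fidx d') * (eidx d == eidx d')%:R.
    by rewrite -big_mkcond big_pred1_eq.
  under eq_bigr => d' _ do rewrite sumE.
  rewrite (bigD1 d) //= (bigD1 (rev d)) //= big1 => [|d' /andP[nd nrd']];
    last first.
    by rewrite eidx_eq (negPf nd) (negPf nrd') mulr0.
  by rewrite eidx_rev eqxx !mulr1 addr0 => /F2_eq.
have urot d : u 0 (fidx (rot d)) = u 0 (fidx d).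
  by rewrite -next_rev fidx_next -urev.
have utail d d' : tail d' = tail d -> u 0 (fidx d') = u 0 (fidx d).
  by move/(same_tail cubicG) => [] ->; rewrite ?urot.
pose h v := if [pick d | tail d == v] is Some d then u 0 (fidx d) else 0.
have hE d : h (tail d) = u 0 (fidx d).
  rewrite /h; case: pickP => [d' /eqP/utail //|/(_ d)].
  by rewrite eqxx.
move=> i j; have [d ->] := fidx_surj i; have [d' ->] := fidx_surj j.
rewrite -!hE; apply: connected_const => {}d.
by rewrite hE urev -hE.
Qed.

Let rank_coboundary : (nV.-1 <= \rank coboundary)%N.
Proof.
rewrite -mxrank_tr; apply: rank_kernel_const => u uB0 i j.
have Bu0 : coboundary *m u^T = 0 by apply: trmx_inj;
  rewrite trmx_mul trmxK trmx0.
rewrite -(enum_valK i) -(enum_valK j).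
apply: (connected_const (h := fun v => u 0 (enum_rank v))) => d.
have := congr1 (fun M : 'cV_nE => M (eidx d) 0) Bu0.
by rewrite coboundary_mul !mxE => /F2_eq.
Qed.

Lemma dual_cycle_is_cut X :
    {in X, forall d, rev d \in X} ->
    {in faces G, forall f, ~~ odd #|f :&: X|} ->
  exists S, forall d, (d \in X) = (tail d \in S) (+) (head d \in S).
Proof.
move=> revX evenX.
have revXE d : (rev d \in X) = (d \in X).
  by apply/idP/idP => /revX //; rewrite revK.
pose x : 'cV[K]_nE := \col_j (enum_val j \in [set dart_edge d | d in X])%:R.
have xE d : x (eidx d) 0 = (d \in X)%:R.
  rewrite mxE eidxE; congr (nat_of_bool _)%:R.
  apply/imsetP/idP => [[d' Xd' /dart_edge_inj[]->]|]; rewrite ?revXE //.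
  by exists d.
have Ax0 : boundary *m x = 0.
  apply/colP => i; rewrite boundary_mul [RHS]mxE.
  under eq_bigr => d _ do rewrite xE.
  under eq_bigl => d do rewrite fidx_eq.
  rewrite -natr_sum -big_mkcondr /= sum1_card.
  have := evenX _ (enum_valP i).
  set c := #|_ :&: X|; set c' := #|_|.
  have -> : c' = c by apply: eq_card => d; rewrite !inE.
  by move=> evc; rewrite -(even_halfK evc) -addnn natrD F2_add.
have rk : (nE <= \rank boundary + \rank coboundary)%N.
  have := genG; rewrite /genus0 -/nV -/nF -/nE.
  have : (0 < nV)%N by case: conG; rewrite -/nV; lia.
  have : (0 < nF)%N.
    case: conG => nV3 _; have /card_gt0P[v _] : (0 < #|vertex G|)%N by lia.
    have [d _] := exists_dart cubicG v.
    by rewrite card_gt0; apply/set0Pn; exists (face_of d);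
      exact: face_of_in_faces.
  by have := rank_boundary; have := rank_coboundary; lia.
have [y xy] := exact_of_rank boundary_coboundary rk Ax0.
exists [set v | y (enum_rank v) 0 == 1] => d.
have := xE d; rewrite xy coboundary_mul !inE.
have F2P (a : K) : a = 0 \/ a = 1.
  by case: a => [[|[|//]] lt]; [left | right]; apply: val_inj.
move: (y _ 0) (y _ 0) => a b.
by case: (F2P a) => ->; case: (F2P b) => ->; case: (d \in X) => // /eqP.
Qed.

End DualCycle.

Section Cuts.
Variable G : map_graph.
Hypotheses (conG : k_connected G 3) (genG : genus0 G) (cubicG : cubic G).
Implicit Types (d o : dart G) (S : {set vertex G}) (X f : {set dart G}).

Local Notation rev := (@reverse_dart G).
Local Notation rot := (rotation G).
Local Notation next := (face_next G).

Lemma rev_neq d : rev d != d.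
Proof.
by apply/eqP => rd; have := tail_neq_head d; rewrite -[in head d]rd eqxx.
Qed.

Lemma card_inner_small S : #|S| <= 2 -> #|inner S| <= 2.
Proof.
move=> S2; have -> : #|inner S| = #|[set val d | d in inner S]|.
  by rewrite card_imset //; exact: val_inj.
have sub : [set val d | d in inner S] \subset [set p in setX S S | p.1 != p.2].
  apply/subsetP => p /imsetP[d dS ->]; move: dS; rewrite !inE => /andP[td hd].
  by rewrite [_ \in S]td [_ \in S]hd tail_neq_head.
apply: leq_trans (subset_leq_card sub) _.
have diag : #|[set p in setX S S | p.1 == p.2]| = #|S|.
  rewrite -(card_imset S (f := fun v => (v, v))); last by move=> v w [].
  apply: eq_card => -[v w]; rewrite !inE /=; apply/andP/imsetP.
    by case=> /andP[Sv _] /eqP<-; exists v.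
  by case=> u Su [-> ->]; rewrite Su.
have := cardsID [set p : vertex G * vertex G | p.1 == p.2] (setX S S).
have -> : setX S S :&: [set p | p.1 == p.2] = [set p in setX S S | p.1 == p.2].
  by apply/setP => p; rewrite !inE.
have -> : setX S S :\: [set p | p.1 == p.2] = [set p in setX S S | p.1 != p.2].
  by apply/setP => p; rewrite !inE andbC.
rewrite diag cardsX; case: #|S| S2 => [|[|[|//]]] _; lia.
Qed.

Lemma small_cut_trivial S : #|leaving S| <= 2 -> S = set0 \/ S = setT.
Proof.
move=> cut2; case: (set_0Vmem S) => [|[u0 Su0]]; first by left.
case: (set_0Vmem (~: S)) => [SC0|[y]]; first by right;
  rewrite -[S]setCK SC0 setC0.
rewrite inE => Sy; exfalso.
pose Q := [set tail d | d in leaving S].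
have Q2 : #|Q| <= 2 by apply: leq_trans (leq_imset_card _ _) cut2.
have [/subsetP sSQ|/subsetPn[u Su Qu]] := boolP (S \subset Q).
  have S2 : #|S| <= 2 by apply: leq_trans Q2; apply/subset_leq_card/subsetP.
  have S1 : 0 < #|S| by apply/card_gt0P; exists u0.
  have cin1 : #|S| = 1 -> #|inner S| = 0.
    case/eqP/cards1P => v Sv; apply: eq_card0 => d; rewrite !inE Sv !inE.
    by apply/negP => /andP[/eqP td /eqP hd]; have := tail_neq_head d;
      rewrite td hd eqxx.
  have eqin := card_inner cubicG S; have in2 := card_inner_small S2.
  have [c1|c1] := eqVneq #|S| 1.
    by have in0 := cin1 c1; rewrite c1 in0 add0n in eqin; rewrite eqin in cut2.
  have c2 : #|S| = 2 by lia.
  by move: eqin in2 cut2; rewrite c2; lia.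
case: conG => _ /(_ Q Q2 u y); rewrite !inE Qu.
have -> : y \notin Q.
  by apply/imsetP => -[d]; rewrite inE => /andP[td _] yd; rewrite yd td in Sy.
move=> /(_ isT isT) /connectP[p pP py].
elim: p u Su Qu pP py => [|w p IHp] u Su Qu /=; first by move=> _ yu;
  rewrite yu Su in Sy.
rewrite !inE => /andP[/and3P[_ Qw auw] pP] py.
apply: (IHp w) => //; apply: contraNT Qu => Sw.
apply/imsetP; exists (exist (fun p : vertex G * vertex G =>
  adj p.1 p.2) (u, w) auw) => //.
by rewrite inE /= Su.
Qed.

Lemma card_coboundary X S :
  (forall d, (d \in X) = (tail d \in S) (+) (head d \in S)) ->
  #|X| = #|leaving S| + #|leaving S|.
Proof.
move=> SP; have -> : X = leaving S :|: leaving (~: S).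
  by apply/setP => d; rewrite SP !inE; do 2!case: (_ \in S).
rewrite -{2}(card_leavingC S) -cardsUI -[LHS]addn0; congr (_ + _).
apply/esym/eqP; rewrite cards_eq0 -subset0; apply/subsetP => d.
by rewrite !inE; do 2!case: (_ \in S).
Qed.

(* A dual cycle is a cut, so short ones are excluded by 3-connectivity. *)
Lemma no_short_dual_cycle X :
    {in X, forall d, rev d \in X} ->
    {in faces G, forall f, ~~ odd #|f :&: X|} ->
  #|X| <= 5 -> X = set0.
Proof.
move=> revX evX X5.
have [S SP] := dual_cycle_is_cut conG genG cubicG revX evX.
have := card_coboundary SP.
move=> X2; have := @small_cut_trivial S => /(_ _)[|S0|ST]; first lia.
  by apply/setP => d; rewrite SP S0 !inE.
by apply/setP => d; rewrite SP ST !inE.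
Qed.

Lemma even_meet_pair (c a b : dart G) : face_of a = face_of b -> a != b ->
  ~~ odd #|face_of c :&: [set a; b]|.
Proof.
move=> eqab nab.
have mE : (a \in face_of c) = (b \in face_of c) by rewrite -!face_of_eq eqab.
case: (boolP (a \in face_of c)) => ac.
  rewrite (setIidPr _) ?cards2 ?nab //.
  by apply/subsetP => x; rewrite !inE => /orP[]/eqP->; rewrite -?mE.
suff -> : face_of c :&: [set a; b] = set0 by rewrite cards0.
apply/setP => x; rewrite !inE; apply/negP => /andP[xc /orP[]/eqP xE].
  by rewrite -xE xc in ac.
by rewrite mE -xE xc in ac.
Qed.

Lemma face_of_rev_neq d : face_of (rev d) != face_of d.
Proof.
apply/eqP => eqf.
have : [set d; rev d] = set0.
  apply: no_short_dual_cycle.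
  - by move=> d'; rewrite !inE => /orP[]/eqP->; rewrite ?revK eqxx ?orbT.
  - by move=> _ /facesP[d' ->]; apply: even_meet_pair;
    rewrite ?eqf // eq_sym rev_neq.
  - by rewrite cards2; case: (_ == _).
by move/setP/(_ d); rewrite !inE eqxx.
Qed.

Lemma faces_share_one_edge d d' :
  face_of d = face_of d' -> face_of (rev d) = face_of (rev d') -> d = d'.
Proof.
move=> eqf eqr; apply/eqP/negPn/negP => ndd'.
have nr : d' != rev d.
  by apply/eqP => E; have := face_of_rev_neq d; rewrite -E eqf eqxx.
have nr' : rev d' != d by rewrite -(inj_eq (@rev_inj G)) revK.
have nrr : rev d' != rev d by rewrite (inj_eq (@rev_inj G)) eq_sym.
have : [set d; d'] :|: [set rev d; rev d'] = set0.
  apply: no_short_dual_cycle.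
  - move=> d''; rewrite !inE => /orP[]/orP[]/eqP->; rewrite ?revK eqxx ?orbT //.
  - move=> _ /facesP[c ->].
    rewrite setIUr cardsU.
    have -> : face_of c :&: [set d; d'] :&: (face_of c :&: [set rev d;
      rev d']) = set0.
      apply/setP => x; rewrite !inE; apply/negP.
      case/andP => /andP[_ xd] /andP[_]; case/orP: xd => /eqP->.
        by rewrite eq_sym (negPf (rev_neq d)) eq_sym (negPf nr').
      by rewrite (negPf nr) eq_sym (negPf (rev_neq d')).
    by rewrite cards0 subn0 oddD !(negPf (even_meet_pair _ _ _)) // eq_sym.
  - by apply: leq_trans (leq_card_setU _ _) _; rewrite !cards2;
    do 2!case: (_ == _).
by move/setP/(_ d); rewrite !inE eqxx.
Qed.

Lemma tail_inj_face d d' : face_of d = face_of d' -> tail d = tail d' -> d = d'.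
Proof.
have no (c : dart G) : face_of c <> face_of (rot c).
  by move/eqP; rewrite face_of_rot eq_sym (negPf (face_of_rev_neq c)).
move=> eqf /esym/(same_tail cubicG)[//|d'E|d'E]; rewrite d'E in eqf.
  by have := no d eqf.
by have := no (rot (rot d)); rewrite (rot3 cubicG) -eqf.
Qed.

End Cuts.

(** * Cuts of size three *)

Section ThreeCuts.
Variable G : map_graph.
Hypotheses (conG : k_connected G 3) (genG : genus0 G) (cubicG : cubic G).
Hypothesis face_size : forall d : dart G, 5 <= #|face_of d| <= 6.
Implicit Types (d o : dart G) (S : {set vertex G}) (X f : {set dart G}).

Local Notation rev := (@reverse_dart G).
Local Notation rot := (rotation G).
Local Notation next := (face_next G).

(* The darts of the faces that the cut separating [S] runs through; those among
   them with both ends in [S] form the boundary of [S]. *)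
Definition crossing S : {set dart G} :=
  [set d | [exists o in leaving S, face_of o == face_of d]].
Definition rim S : {set dart G} := inner S :&: crossing S.

Lemma crossingP S d :
  reflect (exists2 o, o \in leaving S & face_of o = face_of d) (d \in crossing
    S).
Proof. by rewrite [_ \in _]inE; apply: exists_inPP => o; apply: eqP. Qed.

Lemma leaving_crossing S o : o \in leaving S -> o \in crossing S.
Proof. by move=> So; apply/crossingP; exists o. Qed.

Lemma crossing_face S d d' :
  face_of d = face_of d' -> (d \in crossing S) = (d' \in crossing S).
Proof. by move=> eqf; rewrite !inE eqf. Qed.

Lemma crossing_next S d : (next d \in crossing S) = (d \in crossing S).
Proof. exact/crossing_face/face_of_next. Qed.

Lemma exists_entering S o :
  o \in leaving S -> exists2 o', o' \in leaving S & face_of (rev o') = face_of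
    o.
Proof.
move=> So; have := face_count S (face_of_in_faces o).
have : 0 < #|face_of o :&: leaving S|.
  by apply/card_gt0P; exists o; rewrite inE face_of_id.
move=> + eqc; rewrite eqc => /card_gt0P[d]; rewrite inE => /andP[/face_ofP od].
by case/imsetP=> o' So' dE; exists o'; rewrite // -dE.
Qed.

Lemma entering_crossing S o : o \in leaving S -> rev o \in crossing S.
Proof.
move=> So; have := face_count S (face_of_in_faces (rev o)).
have : 0 < #|face_of (rev o) :&: (rev @: leaving S)|.
  by apply/card_gt0P; exists (rev o); rewrite inE face_of_id imset_f.
move=> + eqc; rewrite -eqc => /card_gt0P[d];
  rewrite inE => /andP[/face_ofP od Sd].
by apply/crossingP; exists d.
Qed.

Lemma crossingC S : crossing (~: S) = crossing S.
Proof.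
apply/setP => d; apply/crossingP/idP => [[o]|/crossingP[o So <-]].
  rewrite leavingC => /imsetP[o' So' ->] od.
  by rewrite -(crossing_face _ od) entering_crossing.
by have [o' So' <-] := exists_entering So; exists (rev o') => //;
  rewrite leavingC imset_f.
Qed.

Section Cut.
Variable S : {set vertex G}.
Hypothesis cut3 : #|leaving S| = 3.

Lemma card_crossing : #|crossing S| <= 18.
Proof.
have -> : crossing S = \bigcup_(o in leaving S) face_of o.
  apply/setP => d; apply/crossingP/bigcupP => -[o So od]; exists o => //.
    by rewrite od face_of_id.
  exact/esym/face_ofP.
apply: leq_trans (_ : \sum_(o in leaving S) #|face_of o| <= _).
  elim/big_rec2: _ => [|o n X _ le]; first by rewrite cards0.
  by apply: leq_trans (leq_card_setU _ _) _; rewrite leq_add2l.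
have -> : 18 = #|leaving S| * 6 by rewrite cut3.
rewrite -sum_nat_const; apply: leq_sum => o _.
by case/andP: (face_size o).
Qed.

Lemma card_rims : #|rim S| + #|rim (~: S)| <= 12.
Proof.
have := card_crossing.
rewrite -(cardsID [set d | tail d \in S] (crossing S)).
rewrite -(cardsID [set d | head d \in S] (crossing S :&: _)).
rewrite -(cardsID [set d | head d \in S] (crossing S :\: _)).
have -> : crossing S :&: [set d | tail d \in S] :&:
  [set d | head d \in S] = rim S.
  by apply/setP => d; rewrite !in_setI innerE 2![_ \in finset _]inE -andbA
    andbC.
have -> : crossing S :&: [set d | tail d \in S] :\:
  [set d | head d \in S] = leaving S.
  apply/setP => d; rewrite in_setD !in_setI leavingE 2![_ \in finset _]inE.
  case: (boolP (d \in crossing S)) => cd; first by rewrite /= andbC.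
  by apply/esym; rewrite andbF; apply: contraNF cd; rewrite -leavingE;
    exact: leaving_crossing.
have -> : (crossing S :\: [set d | tail d \in S]) :&:
  [set d | head d \in S] = leaving (~: S).
  apply/setP => d; rewrite in_setI in_setD leavingE 2![_ \in finset _]inE.
  rewrite !in_setC negbK.
  case: (boolP (d \in crossing S)) => cd; first by rewrite andbT.
  apply/esym; rewrite andbF; apply: contraNF cd; rewrite -crossingC.
  by move=> H; apply: leaving_crossing; rewrite leavingE !in_setC negbK.
have -> : (crossing S :\: [set d | tail d \in S]) :\:
  [set d | head d \in S] = rim (~: S).
  apply/setP => d; rewrite !in_setD in_setI innerE crossingC 2![_ \in finset
    _]inE.
  by rewrite !in_setC andbCA andbA.
by rewrite card_leavingC cut3; lia.
Qed.

Lemma rim_rot_notin d : d \in rim S -> rot d \notin rim S.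
Proof.
rewrite !in_setI !innerE => /andP[/andP[td hd] /crossingP[oi Si di]].
apply/negP => /andP[_ /crossingP[oj Sj]]; rewrite face_of_rot => dj.
have nS o : o \in leaving S -> d <> o /\ d <> rev o.
  by rewrite leavingE => /andP[to ho]; split=> dE; case/negP: ho;
    [rewrite -dE | move: td; rewrite dE].
have rneq o : face_of (rev o) <> face_of o.
  by apply/eqP/face_of_rev_neq.
have share := faces_share_one_edge conG genG cubicG.
have nij : oi != oj.
  by apply/eqP => E; apply: (rneq d); rewrite -di -dj E.
have [ok Sk ki] := exists_entering Si; have [ol Sl lj] := exists_entering Sj.
have nik : oi != ok by apply/eqP => E; apply: (rneq ok); rewrite ki E.
have njl : oj != ol by apply/eqP => E; apply: (rneq ol); rewrite lj E.
have nkl : ok != ol.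
  by apply/eqP => E; apply: (rneq d); rewrite -dj -di -ki E lj.
have njk : oj != ok.
  apply/eqP => E; case: (nS _ Sj) => _; apply.
  by apply: share; rewrite ?revK -?dj // E ki di.
have nil : oi != ol.
  apply/eqP => E; case: (nS _ Si) => + _; apply.
  by apply: share; rewrite // -dj -lj E.
have : #|[set oi; oj] :|: [set ok; ol]| <= 3.
  rewrite -cut3; apply/subset_leq_card/subsetP => x.
  by case/setUP=> /set2P[] ->.
have := cardsUI [set oi; oj] [set ok; ol].
have -> : [set oi; oj] :&: [set ok; ol] = set0.
  apply/setP => x; rewrite !inE; apply/negP => /andP[/orP[]/eqP-> /orP[]/eqP E].
  - by rewrite E eqxx in nik.
  - by rewrite E eqxx in nil.
  - by rewrite E eqxx in njk.
  - by rewrite E eqxx in njl.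
by rewrite !cards2 nij nkl cards0; lia.
Qed.

Lemma rim_tail_inj : {in rim S &, injective (@tail G)}.
Proof.
move=> d d' Rd Rd' /esym/(same_tail cubicG)[//|dE|dE].
  by have := rim_rot_notin Rd; rewrite -dE Rd'.
by have := rim_rot_notin Rd'; rewrite dE (rot3 cubicG) Rd.
Qed.

End Cut.

Lemma stable_card X : {in X, forall d, face_of d \subset X} ->
  [\/ #|X| = 0, 5 <= #|X| <= 6 | 10 <= #|X|].
Proof.
move=> stX; have [->|[d Xd]] := set_0Vmem X; first by rewrite cards0;
  constructor 1.
have cX : #|X| = #|face_of d| + #|X :\: face_of d|.
  by rewrite -(cardsID (face_of d) X) (setIidPr (stX _ Xd)).
have := face_size d.
have [E|[d' ]] := set_0Vmem (X :\: face_of d).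
  by rewrite cX E cards0 addn0; constructor 2.
rewrite inE => /andP[nd' Xd']; constructor 3; rewrite cX.
suff : #|face_of d'| <= #|X :\: face_of d| by have := face_size d'; lia.
apply/subset_leq_card/subsetP => x d'x;
  rewrite inE (subsetP (stX _ Xd')) // andbT.
apply: contra nd' => dx; move: d'x dx => /face_ofP + /face_ofP.
by move=> xd' xd; apply/face_ofP; rewrite -xd'.
Qed.

Section Peel.
Variable S : {set vertex G}.
Hypotheses (cut3 : #|leaving S| = 3) (S_gt1 : 1 < #|S|).

Definition border : {set vertex G} := [set tail d | d in rim S].
Definition flat : {set dart G} := inner S :\: crossing S.

Lemma leaving_tail_inj : {in leaving S &, injective (@tail G)}.
Proof.
move=> o o' So So' eqt; apply/eqP/negPn/negP => noo'.
set x := tail o in eqt.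
pose A := leaving S :\: [set o; o'].
pose B := [set d : dart G | tail d == x] :\: [set o; o'].
have cA : #|A| = 1.
  rewrite cardsDS ?cut3 ?cards2 ?noo' //.
  by apply/subsetP => d /set2P[]->.
have cB : #|B| = 1.
  rewrite cardsDS ?(card_darts_at cubicG) ?cards2 ?noo' //.
  by apply/subsetP => d /set2P[]->; rewrite inE -?eqt.
have : #|leaving (S :\ x)| <= 2.
  apply: leq_trans (_ : #|A :|: (rev @: B)| <= _); last first.
    by rewrite (leq_trans (leq_card_setU _ _)) // (card_imset _ (@rev_inj G))
      cA cB.
  apply/subset_leq_card/subsetP => d.
  rewrite leavingE in_setD1 => /andP[/andP[tx td]];
    rewrite in_setD1 negb_and negbK.
  have [hx _|_ /= hd] := eqVneq (head d) x.
    apply/setUP; right; apply/imsetP; exists (rev d); last by rewrite revK.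
    rewrite !inE [tail _]hx eqxx andbT; apply/norP; split; apply/eqP => E.
      by move: So; rewrite -E leavingE => /andP[_]; rewrite [_ \in S]td.
    by move: So'; rewrite -E leavingE => /andP[_]; rewrite [_ \in S]td.
  apply/setUP; left; rewrite in_setD leavingE td hd !andbT.
  by apply/negP => /set2P[] E; move: tx; rewrite E -?eqt eqxx.
case/(small_cut_trivial conG cubicG) => [S0|ST].
  have := cardsD1 x S; rewrite S0 cards0; move: S_gt1; case: (x \in S) => /=;
    lia.
by have := in_setT x; rewrite -ST in_setD1 eqxx.
Qed.

Lemma leaving_inner o d :
  o \in leaving S -> tail d = tail o -> d != o -> d \in inner S.
Proof.
move=> So eqt ndo; have := So; rewrite leavingE innerE eqt => /andP[-> _] /=.
apply: contraR ndo => hd; apply/eqP/leaving_tail_inj => //.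
by rewrite leavingE hd eqt; move: So; rewrite leavingE => /andP[->].
Qed.

Lemma rev_inner d : (rev d \in inner S) = (d \in inner S).
Proof. by rewrite !innerE andbC. Qed.

Lemma rot_leaving_rim o : o \in leaving S -> rot o \in rim S.
Proof.
move=> So; rewrite in_setI (leaving_inner So) ?tail_rot ?rot_neq //.
by rewrite (crossing_face _ (face_of_rot _)) entering_crossing.
Qed.

Lemma prev_leaving_rim o : o \in leaving S -> rev (rot (rot o)) \in rim S.
Proof.
move=> So; rewrite in_setI rev_inner (leaving_inner So) ?tail_rot ?rot2_neq //.
by rewrite (crossing_face _ (face_of_prev cubicG _)) leaving_crossing.
Qed.

Lemma leaving_border o : o \in leaving S -> tail o \in border.
Proof.
by move=> So; apply/imsetP; exists (rot o); rewrite ?tail_rot ?rot_leaving_rim.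
Qed.

Lemma rim_border d : d \in rim S -> tail d \in border.
Proof. exact: imset_f. Qed.

Lemma rim_head d : d \in rim S -> head d \in border.
Proof.
rewrite in_setI innerE -crossing_next -tail_next => /andP[/andP[_ hd] cd].
case: (boolP (head (next d) \in S)) => hn.
  by apply: rim_border; rewrite in_setI innerE hd hn.
by apply: leaving_border; rewrite leavingE hd hn.
Qed.

Lemma rim_prev d : d \in rim S ->
  rot (rot d) \in leaving S \/ head (rot (rot d)) \in border.
Proof.
rewrite in_setI innerE => /andP[/andP[td _] cd].
case: (boolP (head (rot (rot d)) \in S)) => hn; last first.
  by left; rewrite leavingE !tail_rot td.
right; apply: (@rim_border (rev _));
  rewrite in_setI rev_inner innerE !tail_rot td hn.
by rewrite (crossing_face _ (face_of_prev cubicG _)).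
Qed.

Lemma border_sub : border \subset S.
Proof.
by apply/subsetP => v /imsetP[d];
  rewrite in_setI innerE => /andP[/andP[td _] _] ->.
Qed.

Lemma card_border : #|border| = #|rim S|.
Proof. exact/card_in_imset/rim_tail_inj. Qed.

Lemma card_rot_leaving : #|rot @: leaving S| = 3.
Proof. by rewrite card_imset //; exact: perm_inj. Qed.

Lemma rot_leaving_sub : rot @: leaving S \subset rim S.
Proof. by apply/subsetP => _ /imsetP[o So ->]; exact: rot_leaving_rim. Qed.

Lemma leaving_peel : leaving (S :\: border) \subset
  [set rev (rot b) | b in rim S :\: (rot @: leaving S)].
Proof.
apply/subsetP => d; rewrite leavingE !in_setD negb_and negbK.
case/andP=> /andP[nt td] hd.
have {}hd : head d \in border.
  case/orP: hd => // hd; case/negP: nt; apply: leaving_border.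
  by rewrite leavingE td.
case/imsetP: hd => b Rb eqh.
have [E|E|E] : [\/ rev d = b, rev d = rot b | rev d = rot (rot b)].
  exact: same_tail.
- by have := rim_head Rb; rewrite -E (negPf nt).
- apply/imsetP; exists b; last by rewrite -E revK.
  rewrite in_setD Rb andbT; apply/imsetP => -[o So bE].
  case/negP: nt; apply: (@rim_border d).
  by rewrite -[d]revK E bE prev_leaving_rim.
case: (rim_prev Rb); rewrite -E.
  by rewrite leavingE => /andP[_]; rewrite [_ \in S]td.
by rewrite [head _](_ : _ = tail d) // (negPf nt).
Qed.

Lemma card_peel : #|leaving (S :\: border)| <= #|rim S| - 3.
Proof.
apply: leq_trans (subset_leq_card leaving_peel) _.
apply: leq_trans (leq_imset_card _ _) _.
by rewrite cardsDS ?card_rot_leaving // rot_leaving_sub.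
Qed.

Lemma rim_ge3 : 3 <= #|rim S|.
Proof. by rewrite -card_rot_leaving; apply/subset_leq_card/rot_leaving_sub. Qed.

Lemma card_flat : #|flat| + #|rim S| + 3 = 3 * #|S|.
Proof.
have := card_inner cubicG S; rewrite cut3 => <-.
by rewrite -(cardsID (crossing S) (inner S)) -/(rim S) -/flat [#|flat| +
  _]addnC.
Qed.

Lemma flat_face d : d \in flat -> face_of d \subset flat.
Proof.
apply: face_of_sub => {}d; rewrite !in_setD crossing_next => /andP[nc].
rewrite nc !innerE tail_next => /andP[td hd] /=; rewrite hd.
apply: contraR nc => hn; rewrite -crossing_next; apply: leaving_crossing.
by rewrite leavingE tail_next hd.
Qed.

Lemma flat_card_ge5 d : d \in flat -> 5 <= #|S|.
Proof.
move=> fd; have /andP[+ _] := face_size d; move/leq_trans; apply.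
rewrite -(card_in_imset (f := @tail G)); last first.
  move=> x y /face_ofP xd /face_ofP yd.
  by apply: (tail_inj_face conG genG cubicG); rewrite xd.
apply/subset_leq_card/subsetP => v /imsetP[x dx ->].
by move: (subsetP (flat_face fd) _ dx); rewrite in_setD innerE => /and3P[].
Qed.

Lemma peel_nonempty : #|rim S| <= 6 -> S :\: border != set0.
Proof.
move=> rim6; apply/eqP => /eqP; rewrite setD_eq0 => sub.
have cS : #|S| = #|rim S|.
  by rewrite -card_border; congr #|pred_of_set _|; apply/eqP;
    rewrite eqEsubset sub border_sub.
have := rim_ge3; have := card_flat; rewrite cS => cf r3.
have := stable_card (fun d => @flat_face d).
have [r4|r4] := leqP #|rim S| 4; last by case; lia.
have : 0 < #|flat| by lia.
by case/card_gt0P => d /flat_card_ge5; lia.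
Qed.

End Peel.

Lemma no_narrow_three_cut S :
  #|leaving S| = 3 -> 1 < #|S| -> 6 < #|rim S|.
Proof.
move: {2}#|S| (leqnn #|S|) => n; elim: n S => [|n IHn] S Sn cut3 S1.
  by have := leq_trans S1 Sn.
rewrite ltnNge; apply/negP => rim6.
set S' := S :\: border S.
have S'0 : S' != set0 by exact: peel_nonempty.
have bS : #|border S| = #|rim S| by exact: card_border.
have rim3 : 3 <= #|rim S| by exact: rim_ge3.
have cS' : #|S'| + #|rim S| = #|S|.
  by rewrite -bS addnC -(cardsID (border S) S) (setIidPr (border_sub _)).
have cut' : #|leaving S'| <= #|rim S| - 3 by exact: card_peel.
have cut'3 : 3 <= #|leaving S'|.
  rewrite ltnNge; apply/negP => /(small_cut_trivial conG cubicG)[E|E].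
    by rewrite E eqxx in S'0.
  have /card_gt0P[v bv] : 0 < #|border S| by rewrite bS; lia.
  by have := in_setT v; rewrite -E in_setD bv.
have r6 : #|rim S| = 6 by lia.
have {}cut'3 : #|leaving S'| = 3 by lia.
have peelE : leaving S' = [set rev (rot b) | b in rim S :\: (rot @: leaving S)].
  apply/eqP; rewrite eqEcard leaving_peel //= cut'3.
  apply: leq_trans (leq_imset_card _ _) _.
  by rewrite cardsDS ?card_rot_leaving ?rot_leaving_sub // r6.
have [S'1|S'1] := leqP #|S'| 1.
  have c1 : #|S'| = 1 by move: S'0; rewrite -card_gt0; lia.
  have cf : #|flat S| = 12.
    have := card_flat cut3; lia.
  have [u Su] := set0Pn _ S'0; have [d tu] := exists_dart cubicG u.
  have fl x : tail x = u -> face_of x \subset flat S.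
    move=> xu; apply: flat_face => //; move: Su;
      rewrite -xu !in_setD => /andP[nb xS].
    have xin : x \in inner S.
      by rewrite innerE xS; apply: contraR nb => hx; apply: leaving_border;
        rewrite // leavingE xS.
    by rewrite xin andbT; apply: contra nb => cx; apply: rim_border;
      rewrite // in_setI xin.
  have disj (x y : dart G) : tail x = tail y -> x != y -> #|face_of x :&:
    face_of y| = 0.
    move=> eqt /eqP nxy; apply/eqP; rewrite cards_eq0 -subset0;
      apply/subsetP => z.
    rewrite in_setI => /andP[/face_ofP zx /face_ofP zy].
    by case: nxy; apply: (tail_inj_face conG genG cubicG); rewrite // -zx.
  have : #|face_of d :|: (face_of (rot d) :|: face_of (rot (rot d)))| <= 12.
    by rewrite -cf; apply/subset_leq_card; rewrite !subUset !fl // !tail_rot.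
  have := cardsUI (face_of d) (face_of (rot d) :|: face_of (rot (rot d))).
  have := cardsUI (face_of (rot d)) (face_of (rot (rot d))).
  rewrite setIUr [X in _ -> _ + X = _ -> _]cardsU [X in _ + X = _ -> _]disj
    ?tail_rot //; last first.
    by rewrite eq_sym rot_neq.
  rewrite (disj d (rot d)) ?tail_rot // 1?eq_sym ?rot_neq //.
  rewrite (disj d (rot (rot d))) ?tail_rot // 1?eq_sym ?rot2_neq //.
  have := face_size d; have := face_size (rot d);
    have := face_size (rot (rot d)).
  by lia.
have revrim : #|rev @: rim S| <= #|rim (~: S')|.
  apply/subset_leq_card/subsetP => _ /imsetP[d Rd ->].
  have bt := rim_border Rd.
  have bh := rim_head cut3 S1 Rd.
  rewrite in_setI innerE crossingC // !in_setC !in_setD [head _ \in border S]bt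
    [tail _ \in border S]bh /=.
  pose Z := [set x in rim S | rev x \notin crossing S'].
  suff Z0 : Z = set0.
    by have := in_set0 d; rewrite -Z0 inE Rd /= => /negbFE.
  have ZO : Z \subset rot @: leaving S.
    apply/subsetP => x; rewrite inE => /andP[Rx]; apply: contraR => nx.
    have : rev (rot x) \in leaving S'.
      by rewrite peelE; apply/imsetP; exists x; rewrite // in_setD nx.
    by move/entering_crossing; rewrite revK (crossing_face _ (face_of_rot _)).
  have stZ : {in rev @: Z, forall x, next x \in rev @: Z}.
    move=> _ /imsetP[x Zx ->]; move: (Zx); rewrite inE => /andP[_ nx].
    have /imsetP[o So xE] := subsetP ZO _ Zx.
    apply/imsetP; exists (rev (rot (rot o))); last by rewrite next_rev revK xE.
    rewrite inE revK prev_leaving_rim //=; apply: contra nx.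
    by rewrite -xE (crossing_face _ (face_of_rot _)).
  apply/eqP; rewrite -subset0; apply/subsetP => x Zx.
  have := subset_leq_card (face_of_sub stZ (imset_f rev Zx)).
  rewrite (card_imset _ (@rev_inj G)).
  have := subset_leq_card ZO; rewrite card_rot_leaving //.
  by have := face_size (rev x); lia.
have := card_rims cut'3; rewrite -/S'.
rewrite (card_imset _ (@rev_inj G)) r6 in revrim.
have := IHn S' _ cut'3 S'1.
by lia.
Qed.

End ThreeCuts.

(** * Outer faces *)

Section OuterFaces.
Variable G : map_graph.
Hypotheses (conG : k_connected G 3) (genG : genus0 G) (cubicG : cubic G).
Hypothesis face_size : forall d : dart G, 5 <= #|face_of d| <= 6.
Implicit Types (d o : dart G) (S : {set vertex G}) (X f : {set dart G}).

Local Notation rev := (@reverse_dart G).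
Local Notation rot := (rotation G).
Local Notation next := (face_next G).

(* [face_of (outer d)] is the face at [head d] that avoids the edge of [d]. *)
Definition outer d := rot (rot (rev d)).

Lemma tail_outer d : tail (outer d) = head d.
Proof. by rewrite !tail_rot. Qed.

Lemma outerK d : rev (rot (outer d)) = d.
Proof. by rewrite rot3 ?revK. Qed.

Lemma no_three_cut S :
  #|leaving S| = 3 -> 1 < #|S| -> 1 < #|~: S| -> False.
Proof.
move=> cut3 S1 T1; have := card_rims face_size cut3.
have := no_narrow_three_cut conG genG cubicG face_size cut3 S1.
have := no_narrow_three_cut conG genG cubicG face_size (S := ~: S) _ T1.
by rewrite card_leavingC => /(_ cut3); lia.
Qed.

Lemma traject_uniq5 d :
  uniq [:: d; next d; next (next d); next (next (next d));
    next (next (next (next d)))].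
Proof.
have := uniq_traject_porbit next d.
have /andP[/subnKC <- _] := face_size d.
by rewrite trajectD cat_uniq => /andP[].
Qed.

Lemma outer_disjoint d :
  [disjoint face_vertices (face_of (outer d))
          & face_vertices (face_of (outer (rot d)))].
Proof.
pose a := outer d; pose c := next (rot d).
have share := faces_share_one_edge conG genG cubicG.
have fneq := face_of_rev_neq conG genG cubicG.
have nra : next (rev a) = rev d by rewrite next_rev /a /outer rot3.
have nrrd : next (rev d) = rot d by rewrite next_rev.
have fra : face_of (rev a) = face_of (rev d) by rewrite -nra face_of_next.
have fc : face_of c = face_of (rev d) by rewrite /c face_of_next face_of_rot.
have frc : face_of (rev c) = face_of (outer (rot d)).
  by rewrite -face_of_next next_rev /c nextE.
have := traject_uniq5 (rev a); rewrite nra nrrd -/c.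
rewrite /= !inE !negb_or =>
  /and5P[/and4P[nad nard nac nanc] /and3P[_ ndc _] /andP[nrdc _] _ _].
have nfac : face_of a != face_of (rev c).
  apply/eqP => E; have ac : a = rev c by apply: share; rewrite // revK fra fc.
  by rewrite ac revK eqxx in nac.
have nfab : face_of a != face_of (rev d) by rewrite -fra eq_sym.
have nfbc : face_of (rev d) != face_of (rev c) by rewrite -fc eq_sym.
rewrite -frc -/a -setI_eq0; apply/negPn/negP => /set0Pn[w].
rewrite in_setI => /andP[/imsetP[t1 /face_ofP ft1 wt1]
  /imsetP[t2 /face_ofP ft2 wt2]].
have [t fta ftc] : exists2 t, face_of t = face_of a & face_of (rev t) = face_of
  (rev c).
  have eqt : tail t2 = tail t1 by rewrite -wt1 -wt2.
  case/(same_tail cubicG): eqt => t2E.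
  - by rewrite -ft1 -ft2 t2E eqxx in nfac.
  - by exists t1; rewrite // -face_of_rot -t2E.
  - exists (rev t2); last by rewrite revK.
    by rewrite -face_of_rot t2E rot3.
pose X := [set a; t] :|: [set rev a; c] :|: [set rev c; rev t].
have XP x : x \in X -> [\/ x = a \/ x = t, x = rev a \/ x = c | x = rev c \/ x
  = rev t].
  by case/setUP => [/setUP[]|] /set2P;
    [constructor 1 | constructor 2 | constructor 3].
have dis1 : [set a; t] :&: [set rev a; c] = set0.
  apply/setP => x; rewrite in_setI in_set0;
    apply/negP => /andP[/set2P H1 /set2P H2].
  have E1 : face_of x = face_of a by case: H1 => ->.
  have E2 : face_of x = face_of (rev d) by case: H2 => ->.
  by rewrite -E1 E2 eqxx in nfab.
have dis2 : ([set a; t] :|: [set rev a; c]) :&: [set rev c; rev t] = set0.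
  apply/setP => x; rewrite in_setI in_set0;
    apply/negP => /andP[/setUP H1 /set2P H2].
  have E2 : face_of x = face_of (rev c) by case: H2 => ->.
  case: H1 => /set2P H1.
    have E1 : face_of x = face_of a by case: H1 => ->.
    by rewrite -E1 E2 eqxx in nfac.
  have E1 : face_of x = face_of (rev d) by case: H1 => ->.
  by rewrite -E1 E2 eqxx in nfbc.
have nat' : a != t by apply/eqP => E; move: ftc nfbc; rewrite -E fra => ->;
  rewrite eqxx.
have nct : rev c != rev t.
  rewrite (inj_eq (@rev_inj G)); apply/eqP => E.
  by move: fta nfab; rewrite -E fc => ->; rewrite eqxx.
have revX : {in X, forall x, rev x \in X}.
  move=> x /XP[][]->; rewrite !inE ?revK !eqxx ?orbT //.
have evX : {in faces G, forall f, ~~ odd #|f :&: X|}.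
  have evU f P Q : P :&: Q = set0 -> ~~ odd #|f :&: P| -> ~~ odd #|f :&: Q| ->
      ~~ odd #|f :&: (P :|: Q)|.
    move=> PQ0 /negPf oP /negPf oQ.
    by rewrite setIUr cardsU -setIIr PQ0 setI0 cards0 subn0 oddD oP oQ.
  by move=> _ /facesP[x ->]; (apply: (evU); [|apply: (evU)|]) => //;
    apply: even_meet_pair; rewrite // ?fra ?fc.
have cX : #|X| = 6.
  by rewrite 2!cardsU dis1 dis2 cards0 !subn0 !cards2 nat' nac nct.
have [S SP] := dual_cycle_is_cut conG genG cubicG revX evX.
have cut3 : #|leaving S| = 3 by have := card_coboundary SP; rewrite cX; lia.
have XB x : face_of x = face_of (rev d) -> x \in X -> x = rev a \/ x = c.
  move=> fx /XP[H|//|H].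
    by move: nfab; rewrite -fx; case: H => ->; rewrite ?fta eqxx.
  by move: nfbc; rewrite -fx; case: H => ->; rewrite ?ftc eqxx.
have nXd : rev d \notin X.
  by apply/negP => /XB[//|E|E]; [rewrite E eqxx in nad | rewrite E eqxx in ndc].
have nXrd : rot d \notin X.
  apply/negP => /XB[|E|E]; first exact: face_of_rot.
    by rewrite E eqxx in nard.
  by rewrite -E eqxx in nrdc.
have aX : a \in X by rewrite !inE eqxx.
have cXm : c \in X by rewrite !inE eqxx ?orbT.
have nac' : head a != head c.
  apply: contra nanc => /eqP E; apply/eqP/(tail_inj_face conG genG cubicG).
    by rewrite fra face_of_next.
  by rewrite tail_next -E.
move: nXd nXrd aX cXm; rewrite !SP tail_rot tail_outer tail_next.
have ntd := tail_neq_head d.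
have sub2 (T : {set vertex G}) x y : x != y -> x \in T -> y \in T -> 1 < #|T|.
  by move=> nxy Tx Ty; rewrite (cardsD1 x) Tx (cardsD1 y) !inE eq_sym nxy Ty.
rewrite [tail (rev d)]/(head d) [head (rev d)]/(tail d).
case: (boolP (head d \in S)) => hd; case: (boolP (tail d \in S)) => //= td _;
  case: (_ \in S) => //= _; case: (boolP (head a \in S)) => //= ha _;
  case: (boolP (head c \in S)) => //= hc _.
  by apply: (no_three_cut cut3);
    [apply: (sub2 _ _ _ ntd) | apply: (sub2 _ _ _ nac'); rewrite in_setC].
by apply: (no_three_cut cut3);
  [apply: (sub2 _ _ _ nac') | apply: (sub2 _ _ _ ntd); rewrite in_setC].
Qed.

Lemma outer_not_alternating M d :
    perfect_matching M -> dart_edge d \in M ->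
  ~ alternating M (face_of (outer d)).
Proof.
case=> subM uniqM Md altM.
set a := outer d in altM; pose p := rev (rot (rot a)).
have fp : p \in face_of a by apply/face_ofP; exact: face_of_prev.
have := altM _ fp; rewrite next_prev // => aM.
have /cards1P[E ME] : #|[set E in M | head d \in E]| == 1 by rewrite uniqM.
have MP E' : E' \in M -> head d \in E' -> E' = dart_edge d.
  have mem F : F \in M -> head d \in F -> F = E.
    by move=> MF dF; apply/set1P; rewrite -ME inE MF.
  by move=> M' d'; rewrite (mem _ M' d') [RHS]mem // !inE eqxx orbT.
have ta : tail a = head d by exact: tail_outer.
have hp : head p = head d by rewrite -ta;
  exact: etrans (tail_rot _) (tail_rot _).
have ra : rot a = rev d by rewrite /a /outer rot3.
have [Ma|Ma] := boolP (dart_edge a \in M).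
  have /dart_edge_inj[E'|E'] : dart_edge a = dart_edge d.
    by apply: MP => //; rewrite !inE -ta eqxx.
    by have := tail_neq_head d; rewrite -ta E' eqxx.
  by have := rot_neq cubicG a; rewrite ra E' eqxx.
have Mp : dart_edge p \in M by move: aM; rewrite (negPf Ma) => /esym/negbFE.
have /dart_edge_inj[E'|E'] : dart_edge p = dart_edge d.
  by apply: MP => //; rewrite !inE -hp eqxx orbT.
  have := rot_neq cubicG (rot a); rewrite -[rot (rot a)]revK -/p E' ra.
  by rewrite eqxx.
by have := tail_neq_head d; rewrite -hp E' eqxx.
Qed.

Hypothesis resG : k_resonant G 3.

Lemma exists_outer_pentagon v :
  exists2 d : dart G, tail d = v & #|face_of (outer d)| = 5.
Proof.
have [d0 td0] := exists_dart cubicG v.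
have [/exists_inP[d /eqP td /eqP d5]|] :=
    boolP [exists d : dart G in [pred d :
      dart G | tail d == v], #|face_of (outer d)| == 5].
  by exists d.
rewrite negb_exists_in => /forall_inP no5; exfalso.
have hex d : tail d = v -> face_of (outer d) \in hexagons G.
  move=> td; rewrite inE face_of_in_faces /=.
  have /no5 : d \in [pred d : dart G | tail d == v] by rewrite inE td.
  by have /andP[] := face_size (outer d); move: #|face_of _| => n /=; lia.
pose g d := face_of (outer d).
have disj d := outer_disjoint d.
have tr := tail_rot.
have t1 : tail (rot d0) = v by rewrite tail_rot.
have t2 : tail (rot (rot d0)) = v by rewrite !tail_rot.
have d01 := disj d0; have d12 := disj (rot d0).
have := disj (rot (rot d0)); rewrite rot3 // => d20.
have neq d d' : [disjoint face_vertices (g d) & face_vertices (g d')]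
  -> g d != g d'.
  apply: contraL => /eqP <-; rewrite -setI_eq0 setIid.
  by apply/set0Pn; exists (tail (outer d)); apply/imset_f/face_of_id.
pose H := [set g d0; g (rot d0); g (rot (rot d0))].
have HP f : f \in H -> [\/ f = g d0, f = g (rot d0) | f = g (rot (rot d0))].
  by rewrite !inE => /orP[/orP[]|] /eqP;
    [constructor 1 | constructor 2 | constructor 3].
have subH : H \subset hexagons G.
  by apply/subsetP => f /HP[] ->; exact: hex.
have disjH : vertex_disjoint H.
  move=> f f' /HP[]-> /HP[]->; rewrite ?eqxx // => _;
    by rewrite // disjoint_sym.
have cH : #|H| = 3.
  rewrite /H setUC cardsU1 cards2 !inE negb_or (neq _ _ d01) (neq _ _ d20).
  by rewrite eq_sym (neq _ _ d12).
have [_ _ [M [subM uniqM] alt]] := resG (leqnn 3) subH disjH cH.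
have /cards1P[E ME] : #|[set E in M | v \in E]| == 1 by rewrite uniqM.
have : E \in [set E in M | v \in E] by rewrite ME set11.
rewrite inE => /andP[EM vE].
have /edgesP[d dE] := subsetP subM _ EM.
have {d dE} [d td dE] : exists2 d, tail d = v & E = dart_edge d.
  move: vE; rewrite dE !inE => /orP[]/eqP->; first by exists d.
  by exists (rev d); rewrite ?dart_edge_rev.
have gH : g d \in H.
  have : tail d = tail d0 by rewrite td.
  by case/(same_tail cubicG) => ->; rewrite !inE eqxx ?orbT.
by apply: (outer_not_alternating (conj subM uniqM) _ (alt _ gH)); rewrite -dE.
Qed.

Lemma card_vertex_le : #|pentagons G| = 12 -> #|vertex G| <= 60.
Proof.
move=> p12; pose P := [set d : dart G | #|face_of d| == 5].
have : #|P| <= 60.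
  have sub : P \subset \bigcup_(f in pentagons G) f.
    apply/subsetP => d; rewrite inE => d5; apply/bigcupP.
    by exists (face_of d); rewrite ?face_of_id // inE face_of_in_faces.
  apply: leq_trans (subset_leq_card sub) _.
  apply: leq_trans (_ : \sum_(f in pentagons G) #|f| <= _).
    elim/big_rec2: _ => [|f n X _ le]; first by rewrite cards0.
    by apply: leq_trans (leq_card_setU _ _) _; rewrite leq_add2l.
  rewrite (eq_bigr (fun=> 5)) => [|f]; last by rewrite inE => /andP[_ /eqP].
  by rewrite sum_nat_const p12.
apply: leq_trans; apply: leq_trans (leq_imset_card (fun d =>
  tail (rev (rot d))) _).
rewrite -cardsT; apply/subset_leq_card/subsetP => v _.
have [d td d5] := exists_outer_pentagon v.
by apply/imsetP; exists (outer d); rewrite ?outerK // inE d5.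
Qed.

End OuterFaces.

Theorem theorem4p1 (F : map_graph) (F_fullerene : fullerene F)
  (F_resonant : k_resonant F 3) : #|vertex F| <= 60.
Proof.
case: F_fullerene => conF genF cubicF p12 facesE.
apply: card_vertex_le => // d.
have := face_of_in_faces d; rewrite facesE => /setUP[];
  rewrite inE => /andP[_ /eqP->] //.
Qed.
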